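(* For every integer $s\geq 2$ there exist constants $c_s>0$ and $n_s$ such that the following holds for every integer $n\geq n_s$. If $G$ is a $K_{s,s}$-free graph which contains a (not necessarily induced) path on $n$ vertices, then $G$ contains an induced path on at least \[ c_s\,\frac{\log\log n}{\log\log\log n}\] vertices.
   Context: A graph is $K_{s,s}$-free if it does not contain the complete bipartite graph $K_{s,s}$ as a (not necessarily induced) subgraph. An induced path is a path $P$ in $G$ such that the subgraph of $G$ induced on $V(P)$ is exactly $P$. Logarithms are natural logarithms. *)

(* Defs.v *)
From mathcomp Require Import all_boot.
From Stdlib Require Import Reals.

Set Implicit Arguments. Unset Strict Implicit. Unset Printing Implicit Defensive.

Definition simple_graph (T : finType) (e : rel T) : Prop :=
  symmetric e /\ irreflexive e.

Definition contains_Kss (T : finType) (e : rel T) (s : nat) : Prop :=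
  exists A B : {set T},
    #|A| = s /\ #|B| = s /\ [disjoint A & B] /\
    (forall a b, a \in A -> b \in B -> e a b).

Definition Kss_free (T : finType) (e : rel T) (s : nat) : Prop :=
  ~ contains_Kss e s.

Definition is_gpath (T : finType) (e : rel T) (p : seq T) : Prop :=
  uniq p /\ sorted e p.

Definition is_induced_path (T : finType) (e : rel T) (p : seq T) : Prop :=
  is_gpath e p /\
  (forall x y, x \in p -> y \in p -> e x y ->
     index y p = (index x p).+1 \/ index x p = (index y p).+1).

(* Main.v *)
(** From a path on n vertices one extracts a long path (a "chain") in which every
    vertex has at most s neighbours among its predecessors. Scan the given path,
    and whenever a vertex ahead acquires s neighbours on the current chain, call
    it heavy. A vertex that just became heavy is adjacent to the last vertex of
    the chain; cut the remaining path at the heavy vertices and keep a longest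
    piece. It starts right after the end of the chain or right after a heavy
    vertex, and in either case the chain extends by one vertex. As the graph is
    K_{s,s}-free, a chain of m vertices produces at most s m^s heavy vertices, and
    each of them costs at most a factor 2 of the remaining length, so m is at
    least a power of log n.

    In a chain with back-degree at most s, start at the last vertex, cut its
    predecessors at its neighbours, keep a longest gap together with the neighbour
    following it, and recurse: every vertex of the resulting induced path costs a
    factor s + 1, which gives a length of order log m, that is log log n. *)

Require Import Defs.
From mathcomp Require Import all_boot zify.
From Stdlib Require Import Reals Lra.
(* [Reals] rebinds [^] on [nat] to [Nat.pow]; this restores [expn]. *)
From mathcomp Require Import ssrnat.

Set Implicit Arguments. Unset Strict Implicit. Unset Printing Implicit Defensive.

(** The entries satisfying [a] cut the list into blocks, each starting with such an entry, and a
    longest block is at least as long as the average. In the induction on [q], [b] is the part of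
    the current block read so far. *)
Lemma longest_gap (T : eqType) (a : pred T) (q b : seq T) (x : T) :
  a x -> all (predC a) b ->
  exists l h g r, [/\ x :: b ++ q = l ++ h :: g ++ r, a h, all (predC a) g
    & size (x :: b ++ q) <= (size g).+1 * count a (x :: b ++ q)].
Proof.
elim: q x b => [|y q IH] x b ax ab.
  exists [::], x, b, [::]; split=> //=.
  by rewrite cats0 ax leq_pmulr.
case: (boolP (a y)) => ay; last first.
  have := IH x (rcons b y) ax; rewrite all_rcons /= ay ab cat_rcons.
  by apply.
have /= [l [h [g [r [E ah ag sz]]]]] := IH y [::] ay isT.
have cb : count a b = 0 by apply/eqP; rewrite -leqn0 leqNgt -has_count -all_predC.
have [le|lt] := leqP (size b) (size g).
  exists (x :: b ++ l), h, g, r; split=> //=.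
    by rewrite E catA.
  by rewrite size_cat /= count_cat /= cb ax; move: sz le; rewrite ay; nia.
exists [::], x, b, (y :: q); split=> //=.
by rewrite size_cat /= count_cat /= cb ax; move: sz lt; rewrite ay; nia.
Qed.

(** * Counting heavy vertices *)

Section Graph.

Variables (T : finType) (e : rel T).

(** Each [h] in [R] has an [s]-set of neighbours on [c]. There are at most [size c ^ s] such sets,
    and more than [s] vertices sharing one of them would give a K_{s,s}. *)
Lemma heavy_bound (s : nat) (c : seq T) (R : {set T}) :
  Kss_free e s -> 0 < s -> [disjoint R & c] ->
  (forall h, h \in R -> s <= count (e h) c) -> uniq c ->
  #|R| <= s * size c ^ s.
Proof.
move=> Kfree s0 dRc hR uc.
pose X := [set x in c].
pose D := [set A : {set T} | A \subset X & #|A| == s].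
pose F (A : {set T}) := [set h in R | [forall b in A, e h b]].
have cX : #|X| = size c by rewrite cardsE; apply/card_uniqP.
have cD : #|D| <= size c ^ s.
  rewrite cards_draws cX.
  apply: (@leq_trans ('C(size c, s) * s`!)); first by rewrite leq_pmulr ?fact_gt0.
  rewrite bin_ffact; elim: s {Kfree s0 hR D F} => [|m IH]; first by rewrite ffactn0.
  by rewrite ffactnSr expnSr leq_mul // leq_subr.
have cF A : A \in D -> #|F A| <= s.
  rewrite inE => /andP[sA /eqP cA]; rewrite leqNgt; apply/negP => lt.
  have /card_geqP [w [uw sw subw]] := ltnW lt.
  apply: Kfree; exists [set x in w], A; split; last (split=> //; split).
  - by rewrite cardsE -sw; apply/card_uniqP.
  - rewrite disjoint_subset; apply/subsetP => x; rewrite !inE => /subw.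
    rewrite inE => /andP[xR _]; apply/negP => xA.
    have := subsetP sA _ xA; rewrite inE => xc.
    by move: (disjointFr dRc xR); rewrite xc.
  - move=> x b; rewrite inE => /subw; rewrite inE => /andP[_ /forall_inP H] bA.
    exact: H.
have RF : R \subset \bigcup_(A in D) F A.
  apply/subsetP => h hh; have := hR h hh.
  rewrite -size_filter => le.
  have /card_geqP [w [uw sw subw]] : s <= #|[set x in filter (e h) c]|.
    by rewrite cardsE (card_uniqP (filter_uniq _ uc)).
  apply/bigcupP; exists [set x in w].
    rewrite inE; apply/andP; split.
      apply/subsetP => x; rewrite !inE => /subw.
      by rewrite inE mem_filter => /andP[].
    by rewrite cardsE -sw; apply/eqP/card_uniqP.
  rewrite inE hh; apply/forall_inP => b; rewrite inE => /subw.
  by rewrite inE mem_filter => /andP[].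
apply: (leq_trans (subset_leq_card RF)).
apply: (@leq_trans (\sum_(A in D) #|F A|)).
  elim/big_rec2: _ => [|A n B _ le]; first by rewrite cards0.
  by rewrite (leq_trans (leq_card_setU _ _)) // leq_add2l.
apply: (@leq_trans (\sum_(A in D) s)); first exact: leq_sum.
by rewrite sum_nat_const mulnC leq_mul2l cD orbT.
Qed.


(** * Building a chain of bounded back-degree *)

Fixpoint back_degree_le (s : nat) (c : seq T) : bool :=
  if c is y :: r then (count (e y) r <= s) && back_degree_le s r else true.

(* The chain is [x :: c], newest vertex first; [Q] is the part of the path still
   ahead, starting at a neighbour of [x], and [R] holds the discarded heavy
   vertices. Vertices of [Q] may still become heavy because of [x]. *)
Definition state (s n : nat) (x : T) (c Q : seq T) (R : {set T}) : Prop :=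
  [/\ [/\ uniq ((x :: c) ++ Q), path e x c & path e x Q],
      back_degree_le s (x :: c),
      forall h, h \in R -> h \notin (x :: c) ++ Q /\ s <= count (e h) (x :: c),
      forall q, q \in Q -> count (e q) c < s
    & n <= (size Q).+1 * 2 ^ ((size c).+1 + #|R|)].

Lemma state_step (s n : nat) (x : T) (c Q : seq T) (R : {set T}) :
  symmetric e -> Kss_free e s -> 0 < s ->
  2 ^ ((size c).+1 + s * (size c).+1 ^ s) < n ->
  state s n x c Q R ->
  exists y Q' R', state s n y (x :: c) Q' R'.
Proof.
move=> esym Kfree s0 big [[uxcQ pc pQ] bd hR ltQ szn].
have /and3P [uc nQ uQ] : [&& uniq (x :: c), ~~ has [in x :: c] Q & uniq Q].
  by rewrite -cat_uniq.
have cQ q : q \in Q -> q \notin x :: c by move/hasPn: nQ; apply.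
have xQ : x \notin Q by apply/negP => /cQ; rewrite inE eqxx.
pose hv q := s <= count (e q) (x :: c).
pose H := [set q in Q | hv q].
have inH q : (q \in H) = (q \in Q) && hv q by rewrite inE.
have cH : #|H| = count hv Q.
  rewrite -size_filter -(card_uniqP (filter_uniq hv uQ)).
  by apply: eq_card => q; rewrite inH mem_filter andbC.
have Rc q : q \in R -> [/\ q \notin x :: c, q \notin Q & hv q].
  by move=> /hR []; rewrite mem_cat negb_or => /andP[].
have cRH : #|R :|: H| = #|R| + #|H|.
  apply/eqP; rewrite (leq_card_setU R H).2; apply/pred0P => q /=.
  by apply/negP => /andP[/Rc [_ /negP qQ _]]; rewrite inH => /andP[].
have RHle : #|R| + #|H| <= s * (size c).+1 ^ s.
  rewrite -cRH; apply: (heavy_bound (c := x :: c)) => //.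
    apply/pred0P => q /=; apply/negP => /andP[]; rewrite in_setU inH.
    by case/orP => [/Rc [/negP]//|/andP[/cQ /negP]].
  by move=> h; rewrite in_setU inH => /orP[/hR []|/andP[]].
(* Before [x] joined the chain, [q] had fewer than [s] neighbours on it, so a newly heavy [q] must
   be adjacent to [x]. *)
have hvx q : q \in Q -> hv q -> e q x.
  by move=> /ltQ lt; rewrite /hv /=; case: (e q x) => //; rewrite add0n leqNgt lt.
(* Placing [x] in front as a cut lets the piece of [Q] before the first heavy vertex compete too. *)
have [l [h [g [r [E ah ag sz]]]]] :=
  @longest_gap _ [pred q | (q == x) || hv q] Q [::] x (introT orP (or_introl (eqxx x))) isT.
rewrite /= in E ah ag sz.
(* There are [1 + #|H|] pieces, and 1 + k is at most 2 ^ k. *)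
have {sz} sz : (size Q).+1 <= (size g).+1 * 2 ^ #|H|.
  apply: (leq_trans sz); rewrite leq_mul2l; apply/orP; right.
  rewrite eqxx /= cH.
  rewrite (@eq_in_count _ _ hv Q); first by rewrite add1n ltn_expl.
  by move=> q qQ /=; case: eqP qQ xQ => // -> ->.
have {}szn : n <= (size g).+1 * 2 ^ ((size c).+1 + (#|R| + #|H|)).
  apply: (leq_trans szn).
  by rewrite addnA (expnD 2 _ #|H|) [leqRHS]mulnCA [leqLHS]mulnC leq_mul2l sz orbT.
have gP q : q \in g -> ~~ hv q.
  by move=> /(allP ag) /=; rewrite negb_or => /andP[].
have hd q : ~~ hv q -> count (e q) (x :: c) < s by rewrite /hv ltnNge.
(* First case: the piece directly follows [x], and its first vertex extends the chain. An empty
   piece would contradict [big], by [RHle]. *)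
case: l E => [|x' l] /= [Ex EQ].
  case: g => [|q g] in ag szn gP EQ sz *.
    exfalso; move: szn; rewrite mul1n leqNgt => /negP; apply.
    by apply: leq_ltn_trans big; rewrite leq_exp2l // leq_add2l.
  have qQ q' : q' \in q :: g -> q' \in Q by rewrite EQ mem_cat => ->.
  exists q, g, (R :|: H).
  move: uQ pQ; rewrite EQ cat_uniq cat_path => /andP[uqg _] /andP[/= /andP[exq pg] _].
  have [qg ug] : q \notin g /\ uniq g by apply/andP.
  have xgc q' : q' \in q :: g -> q' \notin x :: c by move=> /qQ /cQ.
  have RHn q' : q' \in R :|: H -> [/\ q' \notin x :: c, q' \notin q :: g & hv q'].
    rewrite in_setU inH => /orP[/Rc [nc nQ' hq]|/andP[/cQ nc hq]]; split=> //.
      by apply: contra nQ' => /qQ.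
    by apply/negP => /gP; rewrite hq.
  split.
  - split=> //; last by rewrite /= esym exq.
    rewrite cat_cons cons_uniq mem_cat negb_or xgc ?mem_head // qg cat_uniq uc ug /= andbT.
    by apply/hasPn => q' q'g; apply: xgc; rewrite inE q'g orbT.
  - by rewrite /= in bd *; rewrite bd andbT ltnW // hd // gP // inE eqxx.
  - move=> q' /RHn [nc ng hq]; split; last by rewrite /= (leq_trans hq) ?leq_addl.
    move: ng; rewrite cat_cons !inE mem_cat negb_or => /andP[/negbTE-> /negbTE->].
    by rewrite orbF.
  - by move=> q' q'g; apply/hd/gP; rewrite inE q'g orbT.
  - rewrite cRH; apply: (leq_trans szn).
    (* The vertex moved from the piece to the chain costs at most the factor 2 gained from the
       longer chain. *)
    have le : (size g).+2 <= (size g).+1 * 2 by apply: ltn_Pmulr.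
    by rewrite /= (addSn (size c).+1) expnS mulnA leq_mul2r le orbT.
(* Second case: the piece follows a heavy vertex [h], which itself extends the chain. *)
subst x'.
have hQ : h \in Q by rewrite EQ mem_cat inE eqxx orbT.
have hh : hv h by case/orP: ah => // /eqP hx; move: xQ; rewrite -hx hQ.
have gQ q : q \in g -> q \in Q by rewrite EQ !(mem_cat, inE) => ->; rewrite !orbT.
have [pg hg ug] : [/\ path e h g, h \notin g & uniq g].
  move: uQ pQ; rewrite EQ cat_uniq cat_path /= cat_uniq cat_path.
  move=> /and3P[_ _ /andP[hgr /andP[-> _]]] /and3P[_ _ /andP[-> _]].
  by move: hgr; rewrite mem_cat negb_or => /andP[->].
exists h, g, ((R :|: H) :\ h); split.
- split=> //; last by rewrite /= hvx.
  rewrite cat_cons cons_uniq mem_cat negb_or hg cQ // cat_uniq uc ug /= andbT.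
  by apply/hasPn => q /gQ; apply: cQ.
(* [h] has fewer than [s] neighbours on [c], and [x] adds only one. *)
- rewrite /= in bd *; rewrite bd andbT.
  by rewrite (leq_trans _ (ltQ _ hQ)) // -add1n leq_add2r leq_b1.
- move=> q; rewrite in_setD1 in_setU inH => /andP[qh qRH].
  have [nc ng hq] : [/\ q \notin x :: c, q \notin g & hv q].
    case/orP: qRH => [/Rc [nc nQ' hq]|/andP[/cQ nc hq]]; split=> //.
      by apply: contra nQ' => /gQ.
    by apply/negP => /gP; rewrite hq.
  split; last by rewrite /= (leq_trans hq) ?leq_addl.
  by rewrite cat_cons inE (negbTE qh) orFb mem_cat negb_or nc.
- by move=> q qg; apply/hd/gP.
(* As [h] joins the chain it leaves the discarded set, so the exponent of 2 is unchanged. *)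
- have := cardsD1 h (R :|: H); rewrite in_setU inH hQ hh orbT cRH => cE.
  by apply: (leq_trans szn); rewrite cE leq_mul2l leq_exp2l //= add1n addnS addSn leqnn ?orbT.
Qed.

Lemma exists_chain (s n m : nat) (p : seq T) :
  symmetric e -> Kss_free e s -> 0 < s -> is_gpath e p -> size p = n ->
  2 ^ (m + s * m ^ s) < n ->
  exists x c, [/\ uniq (x :: c), path e x c, back_degree_le s (x :: c)
    & size c = m].
Proof.
move=> esym Kfree s0 [up sp] szp; case: p => [|x0 p] in up sp szp *.
  by rewrite -szp ltn0.
move=> big.
have [x [c [Q [R [[[uxcQ pc _] bd _ _ _] sz]]]]] :
  exists x c Q R, state s n x c Q R /\ size c = m.
  elim: m => [|m IH] in big *.
    exists x0, [::], p, set0; split=> //; split=> //.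
    - by move=> h; rewrite in_set0.
    - by rewrite cards0 -szp leq_pmulr.
  have [|x [c [Q [R [st sz]]]]] := IH.
    apply: leq_ltn_trans big; rewrite leq_exp2l // leq_add // leq_mul2l.
    by rewrite leq_exp2r // leqnSn orbT.
  have [|y [Q' [R' st']]] := state_step esym Kfree s0 _ st; first by rewrite sz.
  by exists y, (x :: c), Q', R'; split=> //=; rewrite sz.
exists x, c; split=> //.
by move: uxcQ; rewrite cat_uniq => /andP[].
Qed.

(** * Extracting an induced path from a chain *)

Lemma back_degree_le_infix (s : nat) (l g r : seq T) :
  back_degree_le s (l ++ g ++ r) -> back_degree_le s g.
Proof.
elim: l => [|x l IH] /=; last by case/andP.
elim: g => //= x g IH /andP[d /IH ->]; rewrite andbT.
by apply: leq_trans d; rewrite count_cat leq_addr.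
Qed.

Lemma induced_path_cons (x y : T) (p : seq T) :
  symmetric e -> irreflexive e ->
  x \notin y :: p -> e x y -> all (predC (e x)) p ->
  is_induced_path e (y :: p) -> is_induced_path e (x :: y :: p).
Proof.
move=> esym eirr xp exy nxp [[up sp] ind].
have xq q : q \in y :: p -> (x == q) = false.
  by move=> qp; apply: contraNF xp => /eqP ->.
have only q : q \in y :: p -> e x q -> index q (x :: y :: p) = 1.
  move=> qp exq; have := xq q qp; move: qp; rewrite inE => /orP[/eqP->|qp].
    by rewrite /= eqxx => ->.
  by have := allP nxp q qp; rewrite /= exq.
have idx q : q \in y :: p -> index q (x :: y :: p) = (index q (y :: p)).+1.
  by move=> /xq qx; rewrite /= qx.
split; first by split; [rewrite cons_uniq xp | rewrite /= exy].
move=> u v; rewrite !(in_cons x) => /orP[/eqP-> | up'] /orP[/eqP-> | vp'].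
- by rewrite eirr.
- by move=> /(only _ vp') ->; left; rewrite /= eqxx.
- by rewrite esym => /(only _ up') ->; right; rewrite /= eqxx.
- by rewrite !idx // => /(ind _ _ up' vp') [->|->]; [left | right].
Qed.

(** The gap [g] after the neighbour [h] of [x] contains no neighbour of [x], so [x] can be put in
    front of any induced path that starts at [h] and continues inside [g]. The inclusion in [c]
    passes this confinement through the recursion. *)
Lemma induced_path_of_chain (s t : nat) (x : T) (c : seq T) :
  symmetric e -> irreflexive e -> 0 < s ->
  uniq (x :: c) -> path e x c -> back_degree_le s (x :: c) ->
  s.+1 ^ t <= (size c).+1 ->
  exists p, [/\ size p = t, {subset p <= c} & is_induced_path e (x :: p)].
Proof.
move=> esym eirr s0; elim: t x c => [|t IH] x c.
  move=> _ _ _ _; exists [::]; split=> //; split=> // y z.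
  by rewrite !inE => /eqP-> /eqP->; rewrite eirr.
case: c => [_ _ _|y c].
  by rewrite leqNgt -[X in X < _](expn0 s.+1) ltn_exp2l.
rewrite cons_uniq => /andP[xyc uyc] pxc /andP[dx bd] sz.
have exy : e x y by case/andP: pxc.
have [l [h [g [r [E eh ag szg]]]]] : exists l h g r,
    [/\ y :: c = l ++ h :: g ++ r, e x h, all (predC (e x)) g
      & size (y :: c) <= (size g).+1 * count (e x) (y :: c)].
  exact: (@longest_gap _ (e x) c [::] y exy isT).
(* At most [s] blocks share the predecessors of [x]; the remaining [s.+1 ^ t >= 1] in [s.+1 ^ t.+1]
   pays for [x] itself. *)
have sgt : s.+1 ^ t <= (size g).+1.
  rewrite -(leq_pmul2r s0) -ltnS.
  apply: leq_trans (leq_trans sz _).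
    by rewrite expnS mulSn mulnC -add1n leq_add2r expn_gt0.
  by rewrite ltnS (leq_trans szg) // leq_mul2l dx orbT.
have sub q : q \in h :: g -> q \in y :: c.
  by rewrite E mem_cat -cat_cons mem_cat => ->; rewrite orbT.
have uhg : uniq (h :: g).
  by move: uyc; rewrite E cat_uniq -cat_cons cat_uniq => /and3P[_ _ /andP[]].
have phg : path e h g.
  by move: pxc; rewrite E cat_path /= cat_path => /and3P[_ _ /andP[]].
have dhg : back_degree_le s (h :: g).
  by apply: (@back_degree_le_infix s l _ r); rewrite cat_cons -E.
have [p [szp subp indp]] := IH h g uhg phg dhg sgt.
exists (h :: p); split; first by rewrite /= szp.
  move=> q qp; apply: sub; move: qp; rewrite !inE.
  by case/orP => [->//|/subp ->]; rewrite orbT.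
apply: induced_path_cons => //.
  apply: contra xyc => xhp; apply: sub; move: xhp; rewrite !inE.
  by case/orP => [->//|/subp ->]; rewrite orbT.
by apply/allP => q /subp; apply: (allP ag).
Qed.

Lemma exists_induced_path (s t : nat) (p : seq T) :
  simple_graph e -> Kss_free e s -> 0 < s -> is_gpath e p ->
  2 ^ (s.+1 ^ (s * t).+1) < size p ->
  exists q, is_induced_path e q /\ size q = t.+1.
Proof.
move=> [esym eirr] Kfree s0 gp big.
have t0 : 0 < s.+1 ^ t by rewrite expn_gt0.
have [|x [c [uc pc bd sz]]] :=
  @exists_chain s (size p) (s.+1 ^ t) p esym Kfree s0 gp erefl.
  (* With m = [s.+1 ^ t], m + s m^s is at most (s + 1) m^s. *)
  apply: leq_ltn_trans big; rewrite leq_exp2l // expnS mulSn -expnM (mulnC t).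
  by rewrite leq_add2r leq_exp2l // leq_pmull.
have [|q [szq _ indq]] := @induced_path_of_chain s t x c esym eirr s0 uc pc bd.
  by rewrite sz.
by exists (x :: q); split=> //=; rewrite szq.
Qed.

End Graph.

(** * Logarithmic estimates and conclusion *)

Lemma INR_expn (a b : nat) : INR (expn a b) = (INR a ^ b)%R.
Proof.
elim: b => [|b IH]; first by rewrite expn0.
by rewrite expnS mult_INR IH.
Qed.

Lemma ln_le (x y : R) : (0 < x)%R -> (x <= y)%R -> (ln x <= ln y)%R.
Proof.
move=> x0 /Rle_lt_or_eq_dec [lt|->]; last exact: Rle_refl.
exact/Rlt_le/ln_increasing.
Qed.

Lemma ln_ln_le (a b n : nat) :
  0 < a -> n <= 2 ^ (a ^ b) -> (1 < INR n)%R ->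
  (ln (ln (INR n)) <= INR b * ln (INR a))%R.
Proof.
move=> a0 /leP /le_INR; rewrite INR_expn => le n1.
have a0' : (0 < INR a)%R by apply/lt_0_INR/ltP.
have ln_n0 : (0 < ln (INR n))%R by rewrite -ln_1; apply: ln_increasing; lra.
rewrite -ln_pow // -INR_expn; apply: ln_le => //.
have h2 : (0 < INR 2)%R by rewrite /=; lra.
apply: Rle_trans (ln_le _ le) _; first lra.
rewrite ln_pow // -[X in (_ <= X)%R]Rmult_1_r.
apply: Rmult_le_compat_l; first exact: pos_INR.
(* ln 2 is at most 1, because 2 = 1 + 1 is at most e. *)
by rewrite -(ln_exp 1); apply: ln_le => //; apply: exp_ineq1_le.
Qed.

Theorem theorem1 :
  forall s : nat, 2 <= s ->
  exists (c : R) (ns : nat), (0 < c)%R /\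
    forall n : nat, ns <= n ->
    forall (T : finType) (e : rel T),
      simple_graph e -> Kss_free e s ->
      (exists p : seq T, is_gpath e p /\ size p = n) ->
      exists p : seq T, is_induced_path e p /\
        (c * (ln (ln (INR n)) / ln (ln (ln (INR n)))) <= INR (size p))%R.
Proof.
move=> s s2.
have s0 : 0 < s by apply: ltnW.
pose E t := 2 ^ (s.+1 ^ (s * t).+1).
(* From [N] on, the triple logarithm exceeds 1. *)
have [N HN] := INR_unbounded (exp (exp (exp 1))).
have lns : (0 < ln (INR s.+1))%R.
  rewrite -ln_1; apply: ln_increasing; first lra.
  by rewrite -[1%R]/(INR 1); apply/lt_INR/ltP.
have s1 : (0 < INR s.+1)%R by apply/lt_0_INR/ltP.
exists (/ (INR s.+1 * ln (INR s.+1)))%R, (maxn (E 0).+1 N).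
split; first by apply/Rinv_0_lt_compat/Rmult_lt_0_compat.
move=> n; rewrite geq_max => /andP[En Nn] T e sg Kfree [p [gp szp]].
have Ebound t : E t < n -> t <= n.
  move=> lt; apply: ltnW; apply: ltn_trans lt.
  apply: (@leq_ltn_trans (s * t).+1); first by rewrite leqW // leq_pmull.
  by rewrite (ltn_trans (ltn_expl _ _) (ltn_expl _ _)).
have exE : exists t, E t < n by exists 0.
(* For the largest [t] with [E t < n], the failure at [t.+1] bounds log log n above in terms of
   [t.+1], the size of the induced path. *)
case: (ex_maxnP exE Ebound) => t Et tmax.
have En' : n <= E t.+1 by rewrite leqNgt; apply/negP => /tmax; rewrite ltnn.
have [|q [indq szq]] := @exists_induced_path T e s t p sg Kfree s0 gp.
  by rewrite szp.
exists q; split=> //; rewrite szq.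
have n_large : (exp (exp (exp 1)) < INR n)%R.
  by apply: Rlt_le_trans HN _; apply/le_INR/leP.
have ln1 : (exp (exp 1) < ln (INR n))%R.
  by rewrite -[X in (X < _)%R]ln_exp; apply: ln_increasing => //; apply: exp_pos.
have ln2 : (exp 1 < ln (ln (INR n)))%R.
  by rewrite -[X in (X < _)%R]ln_exp; apply: ln_increasing => //; apply: exp_pos.
have ln3 : (1 < ln (ln (ln (INR n))))%R.
  by rewrite -[X in (X < _)%R]ln_exp; apply: ln_increasing => //; apply: exp_pos.
have n1 : (1 < INR n)%R.
  have e1 x : (0 < x -> 1 < exp x)%R.
    by move=> x0; rewrite -exp_0; apply: exp_increasing.
  by apply: Rlt_trans n_large; do !apply: e1; apply: exp_pos.
have L := ln_ln_le (ltn0Sn s) En' n1.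
have e0 := exp_pos 1.
(* The constant comes from s (t + 1) + 1 <= (s + 1) (t + 1). *)
have step : (ln (ln (INR n)) <= INR t.+1 * (INR s.+1 * ln (INR s.+1)))%R.
  apply: Rle_trans L _; rewrite -Rmult_assoc.
  apply: Rmult_le_compat_r; first lra.
  rewrite -mult_INR; apply/le_INR/leP.
  by rewrite multE mulnS mulnC; nia.
have P := Rmult_lt_0_compat _ _ s1 lns.
(* The denominator exceeds 1, so it suffices to bound the constant times log log n. *)
apply: (@Rle_trans _ (/ (INR s.+1 * ln (INR s.+1)) * ln (ln (INR n)))%R).
  apply: Rmult_le_compat_l; first by apply/Rlt_le/Rinv_0_lt_compat.
  apply: (Rmult_le_reg_r (ln (ln (ln (INR n))))); first lra.
  rewrite /Rdiv Rmult_assoc Rinv_l; last lra.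
  by nra.
apply: (Rmult_le_reg_r _ _ _ P).
rewrite Rmult_assoc (Rmult_comm (ln _)) -Rmult_assoc Rinv_l; lra.
Qed.
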